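(* Let $\lambda>0$ and $1\le q\le2$, and take $h(\lambda,q)=\lambda^{1-q}$ in the definition of the Tsallis hypoentropies. Let $X,Y,Z$ be discrete random variables with $n$, $m$, $l$ values respectively and joint probabilities $p(x_i,y_j,z_k)$. Then the strong subadditivity holds: $$H_{\lambda,q}(X,Y,Z)+H_{\lambda,q}(Z)\le H_{\lambda,q}(X,Z)+H_{\lambda,q}(Y,Z).$$
   Context: The $q$-logarithm is $\ln_q(x)=\frac{x^{1-q}-1}{1-q}$ for $x>0$, $q\neq 1$, with $\ln_1=\log$ (the limit $q\to1$). For a discrete random variable $W$ taking finitely many values with probabilities $p(w)$, the Tsallis hypoentropy with $h(\lambda,q)=\lambda^{1-q}$ is $$H_{\lambda,q}(W)=\lambda^{-q}\left\{-(1+\lambda)\ln_q\frac{1}{1+\lambda}+\sum_{w}(1+\lambda p(w))\ln_q\frac{1}{1+\lambda p(w)}\right\}.$$ The joint hypoentropies $H_{\lambda,q}(X,Y,Z)$, $H_{\lambda,q}(X,Z)$, $H_{\lambda,q}(Y,Z)$ are given by this formula applied to the joint variables $(X,Y,Z)$, $(X,Z)$, $(Y,Z)$, i.e. with the sum running over all tuples of values and $p(w)$ the corresponding joint (marginal) probabilities. *)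

(* Defs.v *)
From HB Require Import structures.
From mathcomp Require Import all_boot all_order all_algebra.
From mathcomp Require Import all_classical all_reals all_analysis.

Set Implicit Arguments.
Unset Strict Implicit.
Unset Printing Implicit Defensive.

Import Order.TTheory GRing.Theory Num.Theory.
Local Open Scope classical_set_scope.
Local Open Scope ring_scope.

(* Meaningful for [0 < x] only; [ln] and [powR] are total functions. *)
Definition lnq (R : realType) (q x : R) : R :=
  if q == 1 then ln x else (x `^ (1 - q) - 1) / (1 - q).

(* A finite type carries no measurable structure in the library, so the
   measurability of a variable with finitely many values is stated on its
   level sets. Some values may be taken with probability 0. *)
Definition finite_rv d (T : measurableType d) (A : finType) (W : T -> A) : Prop :=
  forall w : A, measurable (W @^-1` [set w]).

Definition prob_eq d (T : measurableType d) (R : realType) (P : probability T R)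
    (A : finType) (W : T -> A) (w : A) : R :=
  fine (P (W @^-1` [set w])).

(* The normalisation [lam `^ (- q)] is h(lam, q) / lam for
   h(lam, q) = lam^(1 - q). *)
Definition tsallis_hypoentropy d (T : measurableType d) (R : realType)
    (P : probability T R) (lam q : R) (A : finType) (W : T -> A) : R :=
  lam `^ (- q) *
  (- (1 + lam) * lnq q (1 / (1 + lam)) +
   \sum_(w : A) (1 + lam * prob_eq P W w) *
     lnq q (1 / (1 + lam * prob_eq P W w))).

(* Main.v *)
(* With phi u = (1 + u) ln_(2-q) (1 + u), the hypoentropy of W is, up to the
   factor lam^(-q), phi lam minus the sum of the phi (lam p(w)). For each fixed
   value of Z the claim becomes, for a nonnegative matrix (a_ij) with row sums
   r_i, column sums c_j and total s,
     sum_i phi r_i + sum_j phi c_j <= sum_ij phi a_ij + phi s.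
   Adding the columns one at a time, and then the rows, reduces it to 2 x 2
   matrices, where it says that the gap phi (x + y) - phi x - phi y is
   superadditive on the quadrant. This holds because the second differential of
   the gap is nonnegative on pairs of vectors v, w of the quadrant at any point
   s v + t w, which uses that phi'' >= 0 and that u phi'' u is nondecreasing;
   the latter is where q >= 1 enters. *)

Require Import Defs.
From mathcomp Require Import all_boot all_order all_algebra.
From mathcomp Require Import all_classical all_reals all_analysis.
From mathcomp Require Import ring lra.

Import Order.TTheory GRing.Theory Num.Theory.
Import numFieldNormedType.Exports.
Local Open Scope classical_set_scope.
Local Open Scope ring_scope.

(** * One-variable calculus *)

(** The mean value point is interior, so the sign of [dg] is only needed for [0 < t]; this fits
    [hessian_ge0], which takes positive [s] and [t]. *)
Lemma le_derive_ge0 (R : realType) (g dg : R -> R) :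
  (forall t : R, 0 <= t -> is_derive t 1 g (dg t)) ->
  (forall t : R, 0 < t -> 0 <= dg t) -> g 0 <= g 1.
Proof.
move=> gdg dg_ge0; have [|||c c01 Eg] := @MVT R g dg 0 1; first exact: ltr01.
- by move=> x; rewrite in_itv/= => /andP[/ltW x0 _]; exact: gdg.
- apply: derivable_within_continuous => x; rewrite in_itv/= => /andP[x0 _].
  by have [] := gdg x x0.
move: c01; rewrite in_itv/= => /andP[c0 _].
by rewrite -subr_ge0 Eg subr0 mulr1 dg_ge0.
Qed.

Lemma is_derive_comp_affine (R : realType) (f df : R -> R) (k c t : R) :
  is_derive (k + t * c) 1 f (df (k + t * c)) ->
  is_derive t 1 (fun s => f (k + s * c)) (c * df (k + t * c)).
Proof.
move=> fD; have aD : is_derive t 1 (fun s : R => k + s * c) c.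
  by apply: is_derive_eq; rewrite add0r mul1r scaler0 add0r /GRing.scale/= mulr1.
by rewrite mulrC; exact: (@is_derive1_comp R f (fun s => k + s * c) t _ c fD aD).
Qed.

(** * Superadditivity of the gap and the matrix inequality *)

Section Superadditivity.
Context (R : realType) (f f1 f2 : R -> R).
Context (f_derive : forall u : R, 0 <= u -> is_derive u 1 f (f1 u))
  (f1_derive : forall u : R, 0 <= u -> is_derive u 1 f1 (f2 u))
  (f2_ge0 : forall u : R, 0 <= u -> 0 <= f2 u)
  (f2_incr : forall u v : R, 0 <= u -> u <= v -> u * f2 u <= v * f2 v)
  (f0 : f 0 = 0).

(* Second differential of [f (x + y) - f x - f y] at [(x, y)], applied to the
   directions [(a, b)] and [(c, d)]. *)
Lemma hessian_ge0 (a b c d s t x y : R) :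
  0 <= a -> 0 <= b -> 0 <= c -> 0 <= d -> 0 < s -> 0 < t ->
  x = s * a + t * c -> y = s * b + t * d ->
  0 <= (a + b) * (c + d) * f2 (x + y) - a * c * f2 x - b * d * f2 y.
Proof.
move=> a0 b0 c0 d0 s0 t0 xE yE.
have x0 : 0 <= x by rewrite xE addr_ge0// mulr_ge0// ltW.
have y0 : 0 <= y by rewrite yE addr_ge0// mulr_ge0// ltW.
have S0 := f2_ge0 _ (addr_ge0 x0 y0).
have Sx : x * f2 x <= (x + y) * f2 (x + y) by rewrite f2_incr// lerDl.
have Sy : y * f2 y <= (x + y) * f2 (x + y) by rewrite f2_incr// lerDr.
have ac0 : 0 <= a * c by rewrite mulr_ge0.
have bd0 : 0 <= b * d by rewrite mulr_ge0.
have ad0 : 0 <= a * d by rewrite mulr_ge0.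
have bc0 : 0 <= b * c by rewrite mulr_ge0.
(* If [x] or [y] vanishes, so do both of its coefficients, and the two terms left in the goal
   cancel. *)
have zero u v : 0 <= u -> 0 <= v -> s * u + t * v = 0 -> u = 0 /\ v = 0.
  move=> u0 v0 E; have /eqP := E.
  rewrite paddr_eq0 ?mulr_ge0 ?(ltW s0) ?(ltW t0)//.
  by rewrite !mulf_eq0 (gt_eqF s0) (gt_eqF t0)/= => /andP[/eqP-> /eqP->].
have [x_eq0|x_neq0] := eqVneq x 0.
  have [a_eq0 c_eq0] := zero _ _ a0 c0 (etrans (esym xE) x_eq0).
  by rewrite a_eq0 c_eq0 x_eq0 !add0r !mul0r subr0 subrr.
have [y_eq0|y_neq0] := eqVneq y 0.
  have [b_eq0 d_eq0] := zero _ _ b0 d0 (etrans (esym yE) y_eq0).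
  by rewrite b_eq0 d_eq0 y_eq0 !addr0 !mul0r subr0 subrr.
have xp : 0 < x by rewrite lt_def x_neq0.
have yp : 0 < y by rewrite lt_def y_neq0.
(* The difference of the sides is [(a * y - b * x) * (d * x - c * y)], whose factors have the same
   sign because [(x, y)] lies between the two directions. *)
have cross : a * c * y ^+ 2 + b * d * x ^+ 2 <= (a * d + b * c) * (x * y).
  rewrite -subr_ge0.
  have -> : (a * d + b * c) * (x * y) - (a * c * y ^+ 2 + b * d * x ^+ 2) =
            s * t * (a * d - b * c) ^+ 2 by rewrite xE yE; ring.
  by rewrite mulr_ge0 ?sqr_ge0// mulr_ge0 ?ltW.
(* After multiplication by [x * y], [Sx] and [Sy] bound the subtracted terms by [(a * c * y + b * d
   * x) * (x + y) * f2 (x + y)], and [cross] bounds this coefficient by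
   [(a + b) * (c + d) * (x * y)]. *)
rewrite -(pmulr_rge0 _ (mulr_gt0 xp yp)).
have H1 := ler_wpM2l (mulr_ge0 ac0 y0) Sx.
have H2 := ler_wpM2l (mulr_ge0 bd0 x0) Sy.
have H3 := ler_wpM2r S0 cross.
move: H1 H2 H3; set F := f2 (x + y); set G := f2 x; set H := f2 y.
lra.
Qed.

Lemma gap_superadditive (a b c d : R) :
  0 <= a -> 0 <= b -> 0 <= c -> 0 <= d ->
  (f (a + b) - f a - f b) + (f (c + d) - f c - f d) <=
  f (a + c + (b + d)) - f (a + c) - f (b + d).
Proof.
move=> a0 b0 c0 d0.
(* The inequality is [g 0 <= g 1], and [dg t] is itself an increment
   [h 1 - h 0], whose derivative [dh] is the second differential at
   [t * (c, d) + s * (a, b)]. *)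
pose g t := f (a + b + t * (c + d)) - f (a + t * c) - f (b + t * d)
   - (f (0 + t * (c + d)) - f (0 + t * c) - f (0 + t * d)).
pose dg t := (c + d) * f1 (a + b + t * (c + d)) - c * f1 (a + t * c)
   - d * f1 (b + t * d)
   - ((c + d) * f1 (0 + t * (c + d)) - c * f1 (0 + t * c) - d * f1 (0 + t * d)).
have gdg (t : R) : 0 <= t -> is_derive t 1 g (dg t).
  move=> t0.
  (* The summands [0 +] in [g] give all six terms the form [f (k + s * e)] treated here. *)
  have D (k e : R) : 0 <= k -> 0 <= e ->
      is_derive t 1 (fun s => f (k + s * e)) (e * f1 (k + t * e)).
    by move=> k0 e0; apply: is_derive_comp_affine; apply: f_derive;
      rewrite addr_ge0 ?mulr_ge0.
  rewrite /g /dg.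
  by do ![apply: is_deriveB | apply: D | exact: addr_ge0 | by []].
have dg_ge0 (t : R) : 0 < t -> 0 <= dg t.
  move=> t0.
  pose h s := (c + d) * f1 (t * (c + d) + s * (a + b)) - c * f1 (t * c + s * a)
     - d * f1 (t * d + s * b).
  pose dh s := (c + d) * ((a + b) * f2 (t * (c + d) + s * (a + b)))
     - c * (a * f2 (t * c + s * a)) - d * (b * f2 (t * d + s * b)).
  have : h 0 <= h 1.
    apply: (@le_derive_ge0 R h dh) => s s0.
      have D (e k : R) : 0 <= k -> 0 <= e ->
         is_derive s 1 (fun s => k * f1 (t * k + s * e))
           (k * (e * f2 (t * k + s * e))).
        move=> k0 e0.
        have Df1 : is_derive (t * k + s * e) 1 f1 (f2 (t * k + s * e)).
          by apply: f1_derive; rewrite addr_ge0 ?mulr_ge0 ?(ltW t0).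
        exact: is_deriveZ (is_derive_comp_affine _ _ _ _ _ _ Df1).
      rewrite /h /dh.
      by do ![apply: is_deriveB | apply: D | exact: addr_ge0 | by []].
    have := hessian_ge0 _ _ _ _ _ _ _ _ a0 b0 c0 d0 s0 t0 erefl erefl.
    rewrite /dh.
    rewrite ![t * _ + s * _]addrC.
    rewrite (_ : s * a + t * c + (s * b + t * d) =
                 s * (a + b) + t * (c + d)); last ring.
    by lra.
  rewrite /h /dg !mul0r !mul1r !addr0 !add0r.
  rewrite (addrC (t * (c + d))) (addrC (t * c)) (addrC (t * d)); lra.
have := @le_derive_ge0 R g dg gdg dg_ge0.
rewrite /g !mul0r !mul1r !addr0 !add0r f0.
rewrite (_ : a + c + (b + d) = a + b + (c + d)); last ring.
lra.
Qed.

(** This is the matrix inequality for two columns [v] and [w]: each new row is absorbed by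
    [gap_superadditive], applied to it and to the sums of the other rows. *)
Lemma gap_sum (I : Type) (r : seq I) (v w : I -> R) :
  (forall i, 0 <= v i) -> (forall i, 0 <= w i) ->
  \sum_(i <- r) (f (v i + w i) - f (v i) - f (w i)) <=
  f (\sum_(i <- r) v i + \sum_(i <- r) w i)
    - f (\sum_(i <- r) v i) - f (\sum_(i <- r) w i).
Proof.
move=> v0 w0; elim: r => [|i r IHr]; first by rewrite !big_nil addr0 f0 !subr0.
rewrite !big_cons.
apply: le_trans (gap_superadditive _ _ _ _ (v0 i) (w0 i) _ _).
- by rewrite lerD2l.
- exact: sumr_ge0.
- exact: sumr_ge0.
Qed.

(** Induction on the columns: [gap_sum] is applied to the new column and to the row sums of the
    others; added to the induction hypothesis, it makes the terms in these row sums and in their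
    total cancel. *)
Lemma sum_rows_cols_le (I J : Type) (r : seq I) (s : seq J) (a : I -> J -> R) :
  (forall i j, 0 <= a i j) ->
  \sum_(i <- r) f (\sum_(j <- s) a i j) + \sum_(j <- s) f (\sum_(i <- r) a i j)
  <= \sum_(i <- r) \sum_(j <- s) f (a i j)
     + f (\sum_(i <- r) \sum_(j <- s) a i j).
Proof.
move=> a0; elim: s => [|j s IHs].
  have sum_nil (F : I -> J -> R) : \sum_(i <- r) \sum_(j <- [::]) F i j = 0.
    by apply: big1 => i _; exact: big_nil.
  by rewrite !sum_nil big_nil big1 ?f0 ?addr0// => i _; rewrite big_nil.
have sum_cons (F : I -> J -> R) : \sum_(i <- r) \sum_(k <- j :: s) F i k =
    \sum_(i <- r) F i j + \sum_(i <- r) \sum_(k <- s) F i k.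
  by under eq_bigr do rewrite big_cons; rewrite big_split.
rewrite !sum_cons big_cons.
have := gap_sum _ r (a^~ j) (fun i => \sum_(k <- s) a i k) (a0^~ j)
  (fun i => sumr_ge0 _ (fun k _ => a0 i k)).
under [\sum_(i <- r) f (\sum_(k <- j :: s) a i k)]eq_bigr do rewrite big_cons.
rewrite !sumrB /=; lra.
Qed.

End Superadditivity.

(** * The q-logarithm *)

Section Hypoentropy.
Context (R : realType) (q : R).

Lemma lnq1 : lnq q 1 = 0.
Proof. by rewrite /lnq; case: eqP => _; rewrite ?ln1// powR1 subrr mul0r. Qed.

(** For [q != 1] both sides come from x^(q - 1) - 1, divided by [1 - q]; the value [q = 1] is fixed
    by the exchange of [q] and [2 - q]. *)
Lemma lnqV (x : R) : 0 < x -> lnq q (1 / x) = - lnq (2 - q) x.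
Proof.
move=> x0; rewrite /lnq div1r.
have -> : (2 - q == 1) = (q == 1) by apply/eqP/eqP => ?; lra.
case: eqP => [_|q1]; first by rewrite lnV.
rewrite -powR_inv1 ?ltW// -powRrM.
rewrite (_ : -1 * (1 - q) = 1 - (2 - q)); last ring.
have q1' : 1 - q != 0 by rewrite subr_eq0 eq_sym; apply/eqP.
rewrite (_ : 1 - (2 - q) = - (1 - q)); last ring.
by field.
Qed.

Lemma is_derive_lnq (x : R) : 0 < x -> is_derive x 1 (lnq q) (x `^ (- q)).
Proof.
move=> x0; rewrite /lnq; case: eqP => [->|q1].
  by rewrite powR_inv1 ?ltW//; exact: is_derive1_ln.
have q1' : 1 - q != 0 by rewrite subr_eq0 eq_sym; apply/eqP.
have D : is_derive x 1 (fun y : R => y `^ (1 - q) - 1)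
    ((1 - q) * x `^ (1 - q - 1) - 0).
  by apply: is_deriveB; exact: is_derive1_powR.
rewrite (_ : (fun y : R => _ / _) =
    (1 - q)^-1 \*: (fun y : R => y `^ (1 - q) - 1)); last first.
  by apply/funext => y; rewrite /= mulrC.
apply: is_derive_eq.
rewrite subr0 /GRing.scale/= mulKf//; congr (_ `^ _); ring.
Qed.

End Hypoentropy.

(** * Marginals of variables with finitely many values *)

Lemma fine_prob_sum_fibers (R : realType) (d : measure_display)
    (T : measurableType d) (P : probability T R) (B : finType) (Y : T -> B)
    (A : set T) : measurable A -> finite_rv Y ->
  fine (P A) = \sum_(y : B) fine (P (A `&` Y @^-1` [set y])).
Proof.
move=> mA mY.
have mAY y : measurable (A `&` Y @^-1` [set y]) by exact: measurableI.
rewrite sum_fine; last by move=> y _; exact: fin_num_measure.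
congr fine; rewrite fsbig_seq ?index_enum_uniq//.
rewrite -measure_fin_bigcup//.
- congr (P _); apply/seteqP; split=> [t At|t [y _ []//]].
  by exists (Y t) => //; rewrite /= mem_index_enum.
- by apply: trivIset_setIl; exact: trivIset_preimage1.
Qed.

Lemma finite_rv_pair (d : measure_display) (T : measurableType d)
    (A B : finType) (U : T -> A) (V : T -> B) :
  finite_rv U -> finite_rv V -> finite_rv (fun t => (U t, V t)).
Proof.
move=> mU mV [u v].
rewrite (_ : _ @^-1` _ = U @^-1` [set u] `&` V @^-1` [set v]).
  exact: measurableI.
by apply/seteqP; split=> t /= [-> ->].
Qed.

(** On the event [U = u], [g] sends the value of [Y] to that of [V]; an abstract [g] lets [Y] be any
    coordinate of a tuple [V]. *)
Lemma prob_eq_marginal (R : realType) (d : measure_display)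
    (T : measurableType d) (P : probability T R) (A B C : finType)
    (U : T -> A) (Y : T -> B) (V : T -> C) (u : A) (g : B -> C) :
  finite_rv U -> finite_rv Y ->
  (forall t y, V t = g y <-> U t = u /\ Y t = y) ->
  prob_eq P U u = \sum_(y : B) prob_eq P V (g y).
Proof.
move=> mU mY VE; rewrite /prob_eq (fine_prob_sum_fibers _ _ _ P _ Y)//.
apply: eq_bigr => y _; congr (fine (P _)).
by apply/seteqP; split=> t /=; case: (VE t y) => ? ?; auto.
Qed.

Lemma prob_eq_ge0 (R : realType) (d : measure_display)
    (T : measurableType d) (P : probability T R) (A : finType)
    (W : T -> A) (w : A) : 0 <= prob_eq P W w.
Proof. exact/fine_ge0/measure_ge0. Qed.

(** * The function [phi] and its derivatives *)

Section Phi.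
Context (R : realType) (q : R).

Definition phi (u : R) : R := (1 + u) * lnq (2 - q) (1 + u).

Definition dphi (u : R) : R := lnq (2 - q) (1 + u) + (1 + u) `^ (q - 1).

Definition ddphi (u : R) : R := q * (1 + u) `^ (q - 2).

Lemma is_derive_shift1 (f : R -> R) (df u : R) :
  is_derive (1 + u) 1 f df -> is_derive u 1 (fun s => f (1 + s)) df.
Proof.
move=> D; rewrite -[df]mulr1; have aD : is_derive u 1 (fun s : R => 1 + s) 1.
  by apply: is_derive_eq; rewrite add0r mul1r.
exact: (@is_derive1_comp R f (fun s => 1 + s) u df 1 D aD).
Qed.

Lemma mulr_powRB2 (x : R) : 0 < x -> x * x `^ (q - 2) = x `^ (q - 1).
Proof.
move=> x0; rewrite -{1}[x]powRr1 ?ltW// -powRD ?(gt_eqF x0) ?implybT//.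
by congr (_ `^ _); ring.
Qed.

Lemma is_derive_phi (u : R) : 0 <= u -> is_derive u 1 phi (dphi u).
Proof.
move=> u0; have x0 : 0 < 1 + u by lra.
apply: (is_derive_shift1 (fun x => x * lnq (2 - q) x)).
have lnqD := is_derive_lnq _ (2 - q) _ x0.
have := is_deriveM (is_derive_id (1 + u) (1 : R)) lnqD.
rewrite /GRing.scale/= mulr1 (_ : - (2 - q) = q - 2); last ring.
by rewrite mulr_powRB2// (addrC (_ `^ _)).
Qed.

Lemma is_derive_dphi (u : R) : 0 <= u -> is_derive u 1 dphi (ddphi u).
Proof.
move=> u0; have x0 : 0 < 1 + u by lra.
apply: (is_derive_shift1 (fun x => lnq (2 - q) x + x `^ (q - 1))).
have := is_deriveD (is_derive_lnq _ (2 - q) _ x0) (is_derive1_powR (q - 1) x0).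
rewrite (_ : - (2 - q) = q - 2); last ring.
rewrite (_ : q - 1 - 1 = q - 2); last ring.
by rewrite (_ : _ `^ _ + _ = ddphi u)// /ddphi; ring.
Qed.

Lemma phi0 : phi 0 = 0.
Proof. by rewrite /phi addr0 lnq1 mulr0. Qed.

(* [u / (1 + u)] and [(1 + u) `^ (q - 1)] are both nondecreasing. *)
Lemma mul_ddphi_le (u v : R) : 1 <= q -> 0 <= u -> u <= v ->
  u * ddphi u <= v * ddphi v.
Proof.
move=> q1 u0 uv; have v0 := le_trans u0 uv.
have E w : 0 <= w -> w * ddphi w = q * (w / (1 + w) * (1 + w) `^ (q - 1)).
  move=> w0; have x0 : 0 < 1 + w by lra.
  rewrite -mulr_powRB2// /ddphi; field; lra.
rewrite !E// ler_wpM2l//; first lra.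
apply: ler_pM; rewrite ?powR_ge0 ?divr_ge0//; try lra.
- rewrite -subr_ge0.
  have -> : v / (1 + v) - u / (1 + u) = (v - u) / ((1 + u) * (1 + v)).
    by field; apply/andP; split; lra.
  by rewrite divr_ge0 ?mulr_ge0//; lra.
- by apply: ge0_ler_powR; rewrite ?nnegrE; lra.
Qed.

Lemma tsallis_hypoentropyE (d : measure_display) (T : measurableType d)
    (P : probability T R) (lam : R) (A : finType) (W : T -> A) : 0 < lam ->
  tsallis_hypoentropy P lam q W =
  lam `^ (- q) * (phi lam - \sum_(w : A) phi (lam * prob_eq P W w)).
Proof.
move=> lam0; rewrite /tsallis_hypoentropy lnqV; last lra.
rewrite mulrNN -sumrN; congr (_ * (_ + _)); apply: eq_bigr => w _.
by rewrite lnqV ?mulrN// ltr_wpDr// mulr_ge0 ?prob_eq_ge0// ltW.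
Qed.

End Phi.

Theorem theorem4p7 (R : realType) (d : measure_display) (T : measurableType d)
  (P : probability T R) (lam q : R) (n m l : nat)
  (X : T -> 'I_n) (Y : T -> 'I_m) (Z : T -> 'I_l)
  (lam_gt0 : 0 < lam) (q_ge1 : 1 <= q) (q_le2 : q <= 2)
  (rvX : finite_rv X) (rvY : finite_rv Y) (rvZ : finite_rv Z) :
  tsallis_hypoentropy P lam q (fun t => (X t, Y t, Z t))
    + tsallis_hypoentropy P lam q Z
  <= tsallis_hypoentropy P lam q (fun t => (X t, Z t))
    + tsallis_hypoentropy P lam q (fun t => (Y t, Z t)).
Proof.
rewrite !tsallis_hypoentropyE// -!mulrDr ler_wpM2l ?powR_ge0//.
(* The last coordinate goes to the outer sum, which groups the tuples by the value of [Z]. *)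
have sum_pair (A B : finType) (F : A * B -> R) :
    \sum_(w : A * B) F w = \sum_(b : B) \sum_(a : A) F (a, b).
  by rewrite exchange_big pair_bigA; apply: eq_bigr => -[].
pose p i j k := lam * prob_eq P (fun t => (X t, Y t, Z t)) (i, j, k).
have p_ge0 i j k : 0 <= p i j k.
  by rewrite mulr_ge0 ?prob_eq_ge0// ltW.
have pXZ i k : lam * prob_eq P (fun t => (X t, Z t)) (i, k) = \sum_j p i j k.
  rewrite -mulr_sumr; congr (_ * _).
  apply: prob_eq_marginal => //; first exact: finite_rv_pair.
  by move=> t j; split=> [[<- <- <-]|[[<- <-] <-]].
have pYZ j k : lam * prob_eq P (fun t => (Y t, Z t)) (j, k) = \sum_i p i j k.
  rewrite -mulr_sumr; congr (_ * _).
  apply: prob_eq_marginal rvX _; first exact: finite_rv_pair.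
  by move=> t i; split=> [[<- <- <-]|[[<- <-] <-]].
have pZ k : lam * prob_eq P Z k = \sum_i \sum_j p i j k.
  under eq_bigr do rewrite -pXZ.
  rewrite -mulr_sumr; congr (_ * _).
  apply: prob_eq_marginal rvX _ => // t i.
  by split=> [[<- <-]|[<- <-]].
have sumXYZ : \sum_w phi R q (lam * prob_eq P (fun t => (X t, Y t, Z t)) w) =
    \sum_k \sum_i \sum_j phi R q (p i j k).
  rewrite sum_pair; apply: eq_bigr => k _.
  by rewrite sum_pair exchange_big.
have sumXZ : \sum_w phi R q (lam * prob_eq P (fun t => (X t, Z t)) w) =
    \sum_k \sum_i phi R q (\sum_j p i j k).
  by rewrite sum_pair; do 2![apply: eq_bigr => ? _]; rewrite pXZ.
have sumYZ : \sum_w phi R q (lam * prob_eq P (fun t => (Y t, Z t)) w) =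
    \sum_k \sum_j phi R q (\sum_i p i j k).
  by rewrite sum_pair; do 2![apply: eq_bigr => ? _]; rewrite pYZ.
have sumZ : \sum_k phi R q (lam * prob_eq P Z k) =
    \sum_k phi R q (\sum_i \sum_j p i j k).
  by apply: eq_bigr => k _; rewrite pZ.
rewrite sumXYZ sumXZ sumYZ sumZ.
(* Both sides contain [phi lam] twice; once it is cancelled, negation reverses the inequality and
   the values of [Z] can be compared one by one. *)
rewrite addrACA [leRHS]addrACA -!opprD lerD2l lerN2 -!big_split/=.
apply: ler_sum => k _.
apply: (@sum_rows_cols_le R (phi R q) (dphi R q) (ddphi R q)) => //.
- exact: is_derive_phi.
- exact: is_derive_dphi.
- by move=> u u0; rewrite mulr_ge0 ?powR_ge0//; lra.
- by move=> u v; exact: mul_ddphi_le.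
- exact: phi0.
Qed.
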